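(* Let $G$ be a graph of order $n\geq 2$ which has a Hamiltonian path. Then \[ \lfloor 2n/3 \rfloor +1\leq \chi_d^t(C(G))\leq n+ \lceil n/2 \rceil . \]
   Context: All graphs are finite, simple and undirected. For a graph $G=(V,E)$ with $V=\{v_1,\dots,v_n\}$, the central graph $C(G)$ is the graph with vertex set $V\cup\{c_{ij} : v_iv_j\in E\}$ obtained by subdividing each edge $v_iv_j$ of $G$ exactly once by a new vertex $c_{ij}$ (adjacent to exactly $v_i$ and $v_j$) and joining every pair of distinct vertices non-adjacent in $G$. A total dominator coloring (TDC) of a graph $H$ with no isolated vertices is a proper vertex coloring of $H$ in which every vertex is adjacent to all vertices of some color class. $\chi_d^t(H)$ is the minimum number of color classes in a TDC of $H$. *)

(* Defs.v *)
From HB Require Import structures.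
From mathcomp Require Import all_boot.

Set Implicit Arguments.
Unset Strict Implicit.
Unset Printing Implicit Defensive.

Record sgraph := SGraph {
  vertex :> finType;
  adj : rel vertex;
  adj_sym : symmetric adj;
  adj_irr : irreflexive adj }.

Definition has_hamiltonian_path (G : sgraph) : Prop :=
  exists (x : G) (p : seq G),
    [/\ path (@adj G) x p, uniq (x :: p) & forall v : G, v \in x :: p].

Section Coloring.

Variable H : sgraph.

Definition neighbors (v : H) : {set H} := [set w | adj v w].

Definition no_isolated_vertex : Prop := forall v : H, exists w : H, adj v w.

Definition proper_coloring (C : eqType) (f : H -> C) : bool :=
  [forall v, forall w, adj v w ==> (f v != f w)].

(* The nonempty fibers of f: colors that are not used give no class. *)
Definition color_classes (C : eqType) (f : H -> C) : {set {set H}} :=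
  preim_partition f [set: H].

Definition total_dominator_coloring (C : eqType) (f : H -> C) : bool :=
  proper_coloring f &&
  [forall v, exists A in color_classes f, A \subset neighbors v].

(* No coloring of H has more than #|H| classes, so #|H| colors are enough to  *)
(* realize all of them up to renaming colors. The starting point enum_rank    *)
(* (all vertices colored differently) is a total dominator coloring as soon   *)
(* as H has no isolated vertex, and then the value below is the minimum       *)
(* number of classes, see total_dominator_chromatic_numberP. When H has an    *)
(* isolated vertex there is no such coloring and the value is meaningless.    *)
Definition total_dominator_chromatic_number : nat :=
  #|color_classes
      [arg min_(f < [ffun v => enum_rank v] : {ffun H -> 'I_#|H|}
               | total_dominator_coloring f) #|color_classes f|]|.

Lemma color_classes_eq (C D : eqType) (f : H -> C) (g : H -> D) :
  (forall v w, (f v == f w) = (g v == g w)) ->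
  color_classes f = color_classes g.
Proof.
move=> fg; apply: eq_in_imset => v _ /=.
by apply/setP => w; rewrite !inE fg.
Qed.

Lemma enum_rank_tdc : no_isolated_vertex ->
  total_dominator_coloring ([ffun v => enum_rank v] : {ffun H -> 'I_#|H|}).
Proof.
move=> niso; apply/andP; split.
  apply/forallP => v; apply/forallP => w; apply/implyP => vw.
  rewrite !ffunE (inj_eq enum_rank_inj); apply: contraTneq vw => ->.
  by rewrite adj_irr.
apply/forallP => v; have [w vw] := niso v.
apply/existsP; exists [set w]; rewrite sub1set inE vw andbT.
apply/imsetP; exists w; rewrite ?inE //.
apply/setP => u; rewrite !inE /= !ffunE (inj_eq enum_rank_inj).
by rewrite eq_sym.
Qed.

Lemma total_dominator_chromatic_numberP : no_isolated_vertex ->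
  (exists2 f : H -> 'I_#|H|, total_dominator_coloring f &
     #|color_classes f| = total_dominator_chromatic_number) /\
  (forall (C : eqType) (f : H -> C), total_dominator_coloring f ->
     total_dominator_chromatic_number <= #|color_classes f|).
Proof.
move=> niso; rewrite /total_dominator_chromatic_number.
case: arg_minnP => [|f tf fmin]; first exact: enum_rank_tdc.
split; first by exists f.
move=> C g tg.
pose r v := odflt v [pick w | g w == g v].
have gr v : g (r v) = g v.
  by rewrite /r; case: pickP => [w /eqP|].
have rP v w : g v = g w -> r v = r w.
  rewrite /r => ->; case: pickP => // /(_ w); by rewrite eqxx.
pose h : {ffun H -> 'I_#|H|} := [ffun v => enum_rank (r v)].
have gh v w : (g v == g w) = (h v == h w).
  rewrite !ffunE (inj_eq enum_rank_inj).
  by apply/eqP/eqP => [/rP //|rvw]; rewrite -gr rvw gr.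
rewrite (color_classes_eq gh); apply: fmin.
move: tg; rewrite /total_dominator_coloring (color_classes_eq gh).
congr (_ && _); apply: eq_forallb => v; apply: eq_forallb => w.
by rewrite gh.
Qed.

End Coloring.

Section CentralGraph.

Variable G : sgraph.

Definition edges : {set {set G}} :=
  [set [set p.1; p.2] | p in [set p : G * G | adj p.1 p.2]].

(* inl v is a vertex of G; inr A, with A = {v_i, v_j} an edge, is the vertex  *)
(* c_ij subdividing A.                                                        *)
Definition central_vertex : finType := (G + {A : {set G} | A \in edges})%type.

Definition central_adj : rel central_vertex := fun a b =>
  match a, b with
  | inl v, inl w => (v != w) && ~~ adj v w
  | inl v, inr A => v \in val A
  | inr A, inl v => v \in val A
  | inr _, inr _ => false
  end.

Lemma central_adj_sym : symmetric central_adj.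
Proof. by case=> [v|A] [w|B] //=; rewrite eq_sym adj_sym. Qed.

Lemma central_adj_irr : irreflexive central_adj.
Proof. by case=> [v|A] //=; rewrite eqxx. Qed.

Definition central_graph : sgraph := SGraph central_adj_sym central_adj_irr.

Lemma central_graph_no_isolated_vertex :
  2 <= #|G| -> no_isolated_vertex central_graph.
Proof.
move=> G2 [v|[A eA]].
  have /card_gt0P [w] : 0 < #|[set~ v]| by rewrite cardsC1 -subn1 subn_gt0.
  rewrite !inE => wv; case vw: (adj v w).
    have eA : [set v; w] \in edges.
      by apply/imsetP; exists (v, w); rewrite ?inE.
    by exists (inr (exist (fun A => A \in edges) _ eA)); rewrite /= !inE eqxx.
  by exists (inl w); rewrite /= eq_sym wv vw.
have /imsetP [p _ AE] := eA.
by exists (inl p.1); rewrite /= AE !inE eqxx.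
Qed.

End CentralGraph.

(* Main.v *)
Require Import Defs.
From mathcomp Require Import all_boot.
From mathcomp Require Import zify.

(** In a total dominator coloring f of C(G), the subdivision vertex of an edge
    uw of G is dominated by a class contained in {u, w}.  Hence two adjacent
    vertices of G, neither of which is alone in its class, form a whole class.
    As two vertices of G of the same color are adjacent in G, a class contains
    at most two vertices of G, and at most one if it also contains a
    subdivision vertex ("mixed" class).

    Let s be the number of vertices of G that are solitary in their class, and t
    the number of the other colors of vertices of G, m of which are mixed.  Then
    n <= s + 2t - m, and t <= s + 1 since the color is constant on each run of
    the Hamiltonian path between two of the s vertices.  Either some class has
    only subdivision vertices, so that there are at least s + t + 1 classes, or
    m >= 2: the vertex of G in one mixed class has an incident edge, whose
    subdivision vertex must lie in another mixed class.  Both cases give the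
    lower bound.

    For the upper bound, any set M of edges covering the vertices of G yields a
    total dominator coloring of C(G) with at most n + |M| colors: give the two
    ends of one edge the same color, the other vertices of G and the subdivision
    vertices of M their own colors, and one more color to the remaining
    subdivision vertices.  A vertex of G is then dominated by a subdivision
    vertex of M, and a subdivision vertex by one of its two neighbors, or by
    both for the chosen edge.  A Hamiltonian path contains such an M of size
    ceil(n/2). *)

Set Implicit Arguments.
Unset Strict Implicit.
Unset Printing Implicit Defensive.

Section ColorClass.

Variables (H : sgraph) (C : eqType) (f : H -> C).
Implicit Types u v w : H.

Definition color_class v : {set H} := [set w | f w == f v].

Definition solitary : {set H} := [set v | color_class v == [set v]].

Lemma color_class_refl v : v \in color_class v.
Proof. by rewrite inE. Qed.

Lemma color_class_eq u v : f u = f v -> color_class u = color_class v.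
Proof. by move=> fuv; apply/setP => w; rewrite !inE fuv. Qed.

Lemma color_classesE : color_classes f = color_class @: [set: H].
Proof.
apply: eq_in_imset => v _; apply/setP => w.
by rewrite !inE /= eq_sym.
Qed.

Lemma total_dominator_coloringP :
  reflect ((forall v w, adj v w -> f v != f w) /\
           (forall v, exists u, color_class u \subset neighbors v))
          (total_dominator_coloring f).
Proof.
rewrite /total_dominator_coloring color_classesE.
apply: (iffP andP) => -[proper_f dom_f]; split.
- by move=> v w; move/forallP/(_ v)/forallP/(_ w)/implyP: proper_f.
- move=> v; have /exists_inP [_ /imsetP [u _ ->] sub_v] := forallP dom_f v.
  by exists u.
- by apply/forallP => v; apply/forallP => w; apply/implyP/proper_f.
- apply/forallP => v; have [u sub_v] := dom_f v.
  by apply/exists_inP; exists (color_class u); rewrite ?imset_f.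
Qed.

Lemma solitary_inj u v : u \in solitary -> f v = f u -> v = u.
Proof.
rewrite inE => /eqP class_u fvu.
by apply/set1P; rewrite -class_u inE fvu.
Qed.

Lemma color_class_subset2 u w :
  u \notin solitary -> color_class u \subset [set u; w] ->
  color_class u = [set u; w].
Proof.
move=> u_nsol sub_uw; apply/eqP; rewrite eqEsubset sub_uw.
rewrite subUset !sub1set color_class_refl /=.
apply: contraNT u_nsol => w_notin; rewrite inE eqEsubset.
rewrite sub1set color_class_refl andbT; apply/subsetP => v v_in.
have /set2P [->|vw] := subsetP sub_uw v v_in; first exact: set11.
by rewrite -vw v_in in w_notin.
Qed.

Lemma tdc_degree2_color_class u v w :
  total_dominator_coloring f -> neighbors v = [set u; w] ->
  u \notin solitary -> w \notin solitary -> color_class u = [set u; w].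
Proof.
move=> /total_dominator_coloringP [_ /(_ v) [z]] + nbr_v u_nsol w_nsol.
rewrite nbr_v => sub_uw.
have /set2P [zE|zE] := subsetP sub_uw z (color_class_refl z).
  by apply: color_class_subset2; rewrite // -[X in color_class X]zE.
have class_w : color_class w = [set w; u].
  by apply: color_class_subset2; rewrite // setUC -[X in color_class X]zE.
rewrite setUC -class_w; apply: color_class_eq; apply/eqP.
by have := set22 w u; rewrite -class_w inE.
Qed.

End ColorClass.

Lemma card_color_classes (H : sgraph) (C : finType) (f : H -> C) :
  #|color_classes f| = #|f @: [set: H]|.
Proof.
have -> : color_classes f = (fun c => f @^-1: [set c]) @: (f @: [set: H]).
  rewrite color_classesE -imset_comp; apply: eq_in_imset => v _.
  by apply/setP => w; rewrite !inE.
apply: card_in_imset => _ _ /imsetP [v _ ->] /imsetP [w _ ->].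
by move=> /setP /(_ v); rewrite !inE eqxx => /esym /eqP.
Qed.

Section EdgeCover.

Variable G : sgraph.
Implicit Types (u v w x : G) (A : {set G}) (M : {set {set G}}).

Lemma adj_neq u w : adj u w -> u != w.
Proof. by move=> uw; apply: contraTneq uw => ->; rewrite adj_irr. Qed.

Lemma edgesP A :
  reflect (exists u w, adj u w /\ A = [set u; w]) (A \in edges G).
Proof.
apply: (iffP imsetP) => [[[u w]]|[u [w [uw ->]]]].
  by rewrite inE => uw ->; exists u, w.
by exists (u, w); rewrite ?inE.
Qed.

Lemma mem_edges u w : adj u w -> [set u; w] \in edges G.
Proof. by move=> uw; apply/edgesP; exists u, w. Qed.

Lemma card_edge A : A \in edges G -> #|A| = 2.
Proof.
by move=> /edgesP [u [w [/adj_neq neq_uw ->]]]; rewrite cards2 neq_uw.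
Qed.

Definition edge_cover M : bool := (M \subset edges G) && (cover M == [set: G]).

Lemma edge_coverP M :
  reflect (M \subset edges G /\ forall v, exists2 A, A \in M & v \in A)
          (edge_cover M).
Proof.
apply: (iffP andP) => -[sub_M cov_M]; split=> //.
  by move=> v; apply/bigcupP; rewrite -/(cover M) (eqP cov_M).
by apply/eqP/setP => v; rewrite inE; apply/bigcupP/cov_M.
Qed.

Lemma edge_cover_no_isolated_vertex M : edge_cover M -> no_isolated_vertex G.
Proof.
move=> /edge_coverP [/subsetP sub_M cov_M] v; have [A /sub_M] := cov_M v.
move=> /edgesP [u [w [uw ->]]] /set2P [] ->; first by exists w.
by exists u; rewrite adj_sym.
Qed.

Lemma path_edge_cover x p :
  path (@adj G) x p -> 0 < size p ->
  exists M, [/\ M \subset edges G, {subset x :: p <= cover M}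
              & #|M| <= uphalf (size (x :: p))].
Proof.
have [k] := ubnP (size p); elim: k x p => // k IHk x [|y p] //= size_p.
move=> /andP [/mem_edges xy path_p] _.
case: p size_p path_p => [|z [|w p]] size_p path_p.
- exists [set [set x; y]]; rewrite sub1set cards1; split=> // v.
  by rewrite /cover big_set1 !inE.
- have /andP [/mem_edges yz _] := path_p.
  exists [set [set x; y]; [set y; z]]; split.
  + by rewrite subUset !sub1set xy.
  + move=> v; rewrite /cover !inE => /or3P v_in; apply/bigcupP.
    by case: v_in => /eqP ->;
      [exists [set x; y] | exists [set x; y] | exists [set y; z]];
      rewrite !inE eqxx ?orbT.
  + by rewrite cards2; case: eqP.
have /andP [_ path_z] := path_p.
have [|//|M [sub_M cov_M card_M]] := IHk z (w :: p) _ path_z.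
  by rewrite /= in size_p *; lia.
exists ([set x; y] |: M); split.
- by rewrite subUset sub1set xy.
- move=> v; rewrite /cover bigcup_setU big_set1 -/(cover M) in_setU in_set2.
  by rewrite 2!in_cons orbA => /orP [-> //|/cov_M ->]; rewrite orbT.
- by rewrite cardsU1 /= in card_M *; case: (_ \notin _); lia.
Qed.

Lemma hamiltonian_edge_cover :
  1 < #|G| -> has_hamiltonian_path G ->
  exists2 M, edge_cover M & #|M| <= uphalf #|G|.
Proof.
move=> gt1_G [x [p [path_p uniq_p mem_p]]].
have size_p : size (x :: p) = #|G|.
  by rewrite -(card_uniqP uniq_p); apply: eq_card.
have [|M [sub_M cov_M card_M]] := path_edge_cover path_p.
  by move: gt1_G; rewrite -size_p.
exists M; last by rewrite -size_p.
by rewrite /edge_cover sub_M -subTset; apply/subsetP => v _; apply: cov_M.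
Qed.

End EdgeCover.

Lemma size_undup_map_filter_path (T C : eqType) (e : rel T) (S : pred T)
    (g : T -> C) x p :
  {in predC S &, forall u w, e u w -> g u = g w} -> path e x p ->
  size (undup [seq g u | u <- x :: p & ~~ S u]) <= (count S (x :: p)).+1.
Proof.
(* The induction needs the sharper bound count S for a path that starts in S. *)
move=> const_g; suff strong y q : path e y q ->
    size (undup [seq g u | u <- y :: q & ~~ S u]) <= count S (y :: q) + ~~ S y.
  by move=> /strong /leq_trans; apply; rewrite -addn1 leq_add2l leq_b1.
elim: q y => [|z q IHq] y /=; first by case: (S y).
move=> /andP [eyz /IHq] /=.
case Sy: (S y) => /= le_runs.
  by apply: leq_trans le_runs _; case: (S z) => /=; lia.
case Sz: (S z) le_runs => /= le_runs; first by case: ifP => _ /=; lia.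
have -> : g y = g z by apply: const_g; rewrite ?inE ?Sy ?Sz.
by rewrite inE eqxx.
Qed.

(* Equivalently, G - S has at most |S| + 1 connected components. *)
Lemma hamiltonian_card_imset_setC (G : sgraph) (C : finType) (S : {set G})
    (g : G -> C) :
  has_hamiltonian_path G ->
  {in ~: S &, forall u w, adj u w -> g u = g w} ->
  #|g @: ~: S| <= #|S|.+1.
Proof.
move=> [x [p [path_p uniq_p mem_p]]] const_g.
have const_predC : {in predC (mem S) &, forall u w, adj u w -> g u = g w}.
  by move=> u w uS wS; apply: const_g; rewrite inE.
have <- : count (mem S) (x :: p) = #|S|.
  rewrite -size_filter -(card_uniqP (filter_uniq _ uniq_p)).
  by apply: eq_card => v; rewrite mem_filter mem_p andbT.
apply: leq_trans (size_undup_map_filter_path const_predC path_p).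
rewrite -(card_uniqP (undup_uniq _)) subset_leq_card //.
apply/subsetP => _ /imsetP [v vS ->]; rewrite mem_undup map_f //.
by rewrite mem_filter mem_p andbT -in_setC.
Qed.

Definition subdivision_vertex (G : sgraph) (u w : G) (uw : adj u w) :
    central_graph G :=
  inr (exist (fun A => A \in edges G) _ (mem_edges uw)).

Section CentralColoring.

Variables (G : sgraph) (C : finType) (f : central_graph G -> C).
Hypothesis tdc_f : total_dominator_coloring f.
Implicit Types (u v w : G) (c : C).

Definition vertex_color v : C := f (inl v).

Definition vertex_colors : {set C} := vertex_color @: [set: G].

Definition subdivision_colors : {set C} :=
  [set f (inr A) | A in [set: {A | A \in edges G}]].

Definition mixed_colors : {set C} := vertex_colors :&: subdivision_colors.

Definition solitary_vertices : {set G} := [set v | inl v \in solitary f].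

Definition nonsolitary_colors : {set C} :=
  vertex_color @: ~: solitary_vertices.

Lemma in_solitary_vertices v :
  (v \in solitary_vertices) = (inl v \in solitary f).
Proof. by rewrite [LHS]in_set. Qed.

Lemma neighbors_subdivision_vertex u w (uw : adj u w) :
  neighbors (subdivision_vertex uw) = [set inl u; inl w].
Proof. by apply/setP => -[v|A]; rewrite !inE /= ?inE. Qed.

Lemma card_color_classes_mixed :
  #|color_classes f| + #|mixed_colors| =
  #|vertex_colors| + #|subdivision_colors|.
Proof.
rewrite -cardsUI card_color_classes.
suff -> : f @: [set: central_graph G] = vertex_colors :|: subdivision_colors.
  by [].
apply/setP => c; apply/imsetP/setUP => [[[v|A] _ ->]|[]].
- by left; apply: imset_f.
- by right; apply/imsetP; exists A.
- by case/imsetP => v _ ->; exists (inl v).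
- by case/imsetP => A _ ->; exists (inr A).
Qed.

Lemma proper_central_coloring z z' : central_adj z z' -> f z != f z'.
Proof.
by have /total_dominator_coloringP [proper_f _] := tdc_f; apply: proper_f.
Qed.

Lemma vertex_color_eq_adj u w :
  vertex_color u = vertex_color w -> u != w -> adj u w.
Proof.
move=> fuw neq_uw; apply: contraT => nadj_uw.
have /proper_central_coloring : central_adj (inl u) (inl w).
  by rewrite /= neq_uw nadj_uw.
by rewrite -/(vertex_color u) fuw eqxx.
Qed.

Lemma adj_nonsolitary_color_class u w :
  adj u w -> u \notin solitary_vertices -> w \notin solitary_vertices ->
  color_class f (inl u) = [set inl u; inl w].
Proof.
move=> uw; rewrite !in_solitary_vertices.
exact: tdc_degree2_color_class tdc_f (neighbors_subdivision_vertex uw).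
Qed.

Lemma adj_nonsolitary_vertex_color u w :
  adj u w -> u \notin solitary_vertices -> w \notin solitary_vertices ->
  vertex_color u = vertex_color w.
Proof.
move=> uw u_nsol w_nsol; apply/esym/eqP.
have : inl w \in color_class f (inl u).
  by rewrite (adj_nonsolitary_color_class uw) // set22.
by rewrite inE.
Qed.

Lemma solitary_vertex_color_inj u w :
  u \in solitary_vertices -> vertex_color w = vertex_color u -> w = u.
Proof. by rewrite in_solitary_vertices => u_sol /(solitary_inj u_sol) []. Qed.

Lemma vertex_color_eq_class u w :
  vertex_color u = vertex_color w -> u != w ->
  color_class f (inl u) = [set inl u; inl w].
Proof.
move=> fuw neq_uw; have uw := vertex_color_eq_adj fuw neq_uw.
apply: (adj_nonsolitary_color_class uw).
  apply: contra neq_uw => /solitary_vertex_color_inj u_inj.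
  by rewrite (u_inj w).
by apply: contra neq_uw => /solitary_vertex_color_inj w_inj; rewrite (w_inj u).
Qed.

Lemma card_vertex_color_fiber c :
  #|vertex_color @^-1: [set c]| + (c \in subdivision_colors) <= 2.
Proof.
set F := vertex_color @^-1: [set c].
have [le1_F|/card_gt1P [u [w []]]] := leqP #|F| 1.
  by case: (c \in _); lia.
rewrite !inE => /eqP fu /eqP fw neq_uw.
have class_u := vertex_color_eq_class (etrans fu (esym fw)) neq_uw.
have class_c z : f z = c -> z \in [set inl u; inl w].
  by move=> fz; rewrite -class_u inE fz -fu.
have -> : (c \in subdivision_colors) = false.
  by apply/imsetP => -[A _ /esym /class_c]; rewrite !inE.
have sub_F : F \subset [set u; w].
  by apply/subsetP => v; rewrite !inE => /eqP /class_c; rewrite !inE.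
by rewrite addn0 (leq_trans (subset_leq_card sub_F)) // cards2; case: eqP.
Qed.

Lemma mixed_colorsE :
  mixed_colors = nonsolitary_colors :&: subdivision_colors.
Proof.
apply/eqP; rewrite eqEsubset [X in _ && X]setSI ?imsetS // andbT.
rewrite subsetI subsetIr andbT.
apply/subsetP => c /setIP [/imsetP [v _ ->] /imsetP [A _ fvA]].
rewrite imset_f // in_setC in_solitary_vertices.
by apply/negP => /solitary_inj /(_ (esym fvA)).
Qed.

Lemma card_nonsolitary_mixed_le :
  #|~: solitary_vertices| + #|mixed_colors| <= 2 * #|nonsolitary_colors|.
Proof.
rewrite mixed_colorsE.
have -> : #|nonsolitary_colors :&: subdivision_colors| =
    \sum_(c in nonsolitary_colors) (c \in subdivision_colors).
  by rewrite -big_mkcondr -sum1_card; apply: eq_bigl => c; rewrite in_setI.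
rewrite -sum1_card (partition_big_imset vertex_color) -big_split /=.
rewrite mulnC -sum_nat_const; apply: leq_sum => c _.
apply: leq_trans (card_vertex_color_fiber c); rewrite leq_add2r sum1dep_card.
by apply/subset_leq_card/subsetP => v; rewrite !inE => /andP [].
Qed.

Lemma card_vertex_colors :
  #|vertex_colors| = #|solitary_vertices| + #|nonsolitary_colors|.
Proof.
have inj_sol : {in solitary_vertices &, injective vertex_color}.
  by move=> u w _ w_sol; apply: solitary_vertex_color_inj.
rewrite -(card_in_imset inj_sol) -cardsUI -imsetU setUCr.
rewrite [_ :&: _](_ : _ = set0) ?cards0 ?addn0 //.
apply/setP => c; rewrite !inE; apply/andP => -[/imsetP [u u_sol ->]].
move=> /imsetP [w]; rewrite inE => w_nsol /esym.
by move=> /(solitary_vertex_color_inj u_sol) wu; rewrite wu u_sol in w_nsol.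
Qed.

Lemma card_subdivision_colors_gt1 :
  0 < #|G| -> no_isolated_vertex G ->
  subdivision_colors \subset vertex_colors -> 1 < #|subdivision_colors|.
Proof.
move=> /card_gt0P [x _] no_isolated /subsetP sub_colors.
have mem_subdivision u w (uw : adj u w) :
  f (subdivision_vertex uw) \in subdivision_colors by apply: imset_f.
have [y xy] := no_isolated x.
have /sub_colors /imsetP [v _ fv] := mem_subdivision _ _ xy.
have [w vw] := no_isolated v; apply/card_gt1P.
exists (f (subdivision_vertex vw)), (vertex_color v); split=> //.
  by rewrite -fv.
by apply: proper_central_coloring; rewrite /= set21.
Qed.

Lemma hamiltonian_tdc_lower_bound :
  0 < #|G| -> no_isolated_vertex G -> has_hamiltonian_path G ->
  (2 * #|G|) %/ 3 + 1 <= #|color_classes f|.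
Proof.
move=> gt0_G no_isolated ham_G.
have le_n := card_nonsolitary_mixed_le; have eq_n := cardsC solitary_vertices.
have eq_t := card_vertex_colors; have eq_colors := card_color_classes_mixed.
have le_t : #|nonsolitary_colors| <= #|solitary_vertices|.+1.
  apply: hamiltonian_card_imset_setC ham_G _ => u w.
  by rewrite !in_setC => u_nsol w_nsol uw; apply: adj_nonsolitary_vertex_color.
have [sub_colors|nsub_colors] :=
    boolP (subdivision_colors \subset vertex_colors).
  have := card_subdivision_colors_gt1 gt0_G no_isolated sub_colors.
  by rewrite /mixed_colors (setIidPr sub_colors) in le_n eq_colors; lia.
suff /proper_card : mixed_colors \proper subdivision_colors by lia.
rewrite properEneq subsetIr andbT.
by apply: contra nsub_colors => /eqP/setIidPr.
Qed.

End CentralColoring.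

Section EdgeCoverColoring.

Variables (G : sgraph) (M : {set {set G}}) (a b : G).
Hypotheses (cover_M : edge_cover M) (ab : adj a b).
Implicit Types v w : G.

Definition edge_cover_coloring (z : central_graph G) : G + option {set G} :=
  match z with
  | inl v => inl (if v == b then a else v)
  | inr A => inr (if val A \in M then Some (val A) else None)
  end.

Lemma edge_cover_coloring_inl v w :
  edge_cover_coloring (inl w) = edge_cover_coloring (inl v) ->
  w = v \/ v \in [set a; b] /\ w \in [set a; b].
Proof.
rewrite !inE /= => -[]; case: eqP => [->|_]; case: eqP => [->|_].
- by left.
- by move=> <-; right; rewrite !eqxx orbT.
- by move=> ->; right; rewrite !eqxx orbT.
- by left.
Qed.

Lemma edge_cover_coloring_proper z z' :
  central_adj z z' -> edge_cover_coloring z != edge_cover_coloring z'.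
Proof.
case: z z' => [v|A] [w|B] // /andP [neq_vw]; apply: contraNneq.
move=> /edge_cover_coloring_inl [vw|[]]; first by rewrite vw eqxx in neq_vw.
by move=> /set2P [] wE /set2P [] vE; move: neq_vw;
  rewrite wE vE ?eqxx // adj_sym.
Qed.

Lemma edge_cover_coloring_tdc : total_dominator_coloring edge_cover_coloring.
Proof.
have [/subsetP sub_M cov_M] := edge_coverP _ cover_M.
apply/total_dominator_coloringP; split; first exact: edge_cover_coloring_proper.
move=> [v|A].
  have [A AM vA] := cov_M v; exists (inr (exist _ A (sub_M A AM))).
  apply/subsetP => -[w|B]; rewrite !inE //= AM => /eqP [].
  by case: ifP => // _ [->].
have [sub_ab|/subsetPn [v vA v_ab]] := boolP (val A \subset [set a; b]).
  have AE : val A = [set a; b].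
    by apply/eqP; rewrite eqEcard sub_ab !card_edge ?mem_edges ?(valP A).
  exists (inl a); apply/subsetP => -[w|B]; rewrite !inE // => /eqP.
  by move=> /edge_cover_coloring_inl [->|[_]]; rewrite /= AE ?set21.
exists (inl v); apply/subsetP => -[w|B]; rewrite !inE // => /eqP.
by move=> /edge_cover_coloring_inl [->|[]] //; rewrite (negPf v_ab).
Qed.

Lemma card_edge_cover_coloring_classes :
  #|color_classes edge_cover_coloring| <= #|G| + #|M|.
Proof.
have neq_ab := adj_neq ab.
pose colors : {set G + option {set G}} :=
  inl @: [set~ b] :|: inr @: (None |: Some @: M).
have sub_colors : edge_cover_coloring @: [set: central_graph G] \subset colors.
  apply/subsetP => _ /imsetP [[v|A] _ ->]; apply/setUP; [left | right].
    by apply: imset_f; rewrite !inE; case: ifP => // /negbT.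
  by apply: imset_f; case: ifP => AM; rewrite !inE // imset_f.
rewrite card_color_classes (leq_trans (subset_leq_card sub_colors)) //.
rewrite (leq_trans (leq_card_setU _ _)) // //.
rewrite !card_imset; [|exact: inr_inj|exact: inl_inj].
rewrite cardsU1 cardsC1 card_imset; last exact: Some_inj.
have gt0_G : 0 < #|G| by apply/card_gt0P; exists a.
by case: (_ \notin _); lia.
Qed.

End EdgeCoverColoring.

Lemma edge_cover_chromatic_number_le (G : sgraph) (M : {set {set G}}) :
  1 < #|G| -> edge_cover M ->
  total_dominator_chromatic_number (central_graph G) <= #|G| + #|M|.
Proof.
move=> gt1_G cover_M.
have [_ le_chi] :=
  total_dominator_chromatic_numberP (central_graph_no_isolated_vertex gt1_G).
have /card_gt0P [a _] := ltnW gt1_G.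
have [b ab] := edge_cover_no_isolated_vertex cover_M a.
apply: leq_trans (le_chi _ _ (edge_cover_coloring_tdc cover_M ab)) _.
exact: card_edge_cover_coloring_classes.
Qed.

Theorem theorem2p2 (G : sgraph) (n : nat) (order_G : #|G| = n) (n_ge2 : 2 <= n)
    (ham_G : has_hamiltonian_path G) :
  (2 * n) %/ 3 + 1 <= total_dominator_chromatic_number (central_graph G)
  /\ total_dominator_chromatic_number (central_graph G) <= n + uphalf n.
Proof.
subst n.
have [M cover_M card_M] := hamiltonian_edge_cover n_ge2 ham_G.
split; last first.
  apply: leq_trans (edge_cover_chromatic_number_le n_ge2 cover_M) _.
  by rewrite leq_add2l.
have [[f tdc_f <-] _] :=
  total_dominator_chromatic_numberP (central_graph_no_isolated_vertex n_ge2).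
have no_isolated := edge_cover_no_isolated_vertex cover_M.
exact: hamiltonian_tdc_lower_bound (ltnW n_ge2) no_isolated ham_G.
Qed.
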